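(* For every $n\in\omega$ and every $X\subseteq\beta\omega$ such that $|X|<2^{\mathfrak c}$, the subspace $\beta\omega\setminus X$ of $\beta\omega$ is $n$-cascade countably compact.
   Context: $\mathfrak c=2^{\aleph_0}$. $\beta\omega$ is the Stone–Čech compactification of the discrete space $\omega$, whose points are identified with the ultrafilters on $\omega$ (each $n\in\omega$ being identified with the principal ultrafilter at $n$). For infinite $M\subseteq\omega$ and $n\in\omega$, $[M]^n$ is the set of $n$-element subsets of $M$ (so $[M]^0=\{\emptyset\}$). If $p$ is a free ultrafilter on $\omega$, $A\in p$ and $(x_m:m\in A)$ is a family in a topological space $Y$, then $x\in Y$ is a $p$-limit of it if $\{m\in A:x_m\in U\}\in p$ for every neighborhood $U$ of $x$. Cascade limits: let $Y$ be a topological space, $p$ a free ultrafilter on $\omega$ with $M\in p$, and $f$ a function into $Y$ whose domain contains $[M]^n$. Recursively on $n$, $x\in Y$ is an $[M]^n$-cascade $p$-limit point of $f$ if: for $n=0$, $f(\emptyset)=x$; for $n>0$, there exist $A\in p$ with $A\subseteq M$ and a family $(x_m:m\in A)$ in $Y$ such that for every $m\in A$, $x_m$ is an $[M\setminus(m+1)]^{n-1}$-cascade $p$-limit point of $f_m:[M\setminus(m+1)]^{n-1}\to Y$, $f_m(s)=f(\{m\}\cup s)$, and $x$ is a $p$-limit of $(x_m:m\in A)$. (Here $m+1=\{0,\dots,m\}$.) $Y$ is $n$-cascade countably compact if for every $f:[\omega]^n\to Y$ there is a free ultrafilter $p$ on $\omega$ such that $f$ has an $[\omega]^n$-cascade $p$-limit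 point in $Y$. *)

(* Defs.v *)
From HB Require Import structures.
From mathcomp Require Import all_boot finmap.
From mathcomp Require Import boolp classical_sets functions cardinality filter.
From mathcomp Require Import topology.

Set Implicit Arguments.
Unset Strict Implicit.
Unset Printing Implicit Defensive.

Local Open Scope classical_set_scope.
Local Open Scope card_scope.

Definition card_lt T U (A : set T) (B : set U) : Prop :=
  A #<= B /\ ~ (B #<= A).

Definition free_ultrafilter (p : set_system nat) : Prop :=
  UltraFilter p /\ \bigcap_(A in p) A = set0.

Record beta_omega := BetaOmega {
  beta_filter : set_system nat;
  beta_ultra : UltraFilter beta_filter
}.

HB.instance Definition _ := gen_eqMixin beta_omega.
HB.instance Definition _ := gen_choiceMixin beta_omega.

Definition beta_basic (A : set nat) : set beta_omega := [set q | beta_filter q A].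

Lemma beta_basic_cover : \bigcup_(A in [set: set nat]) beta_basic A = setT.
Proof.
apply/seteqP; split=> // q _; exists setT => //.
by case: q => q uq; exact: filterT.
Qed.

Lemma beta_basic_join (A B : set nat) (q : beta_omega) :
  [set: set nat] A -> [set: set nat] B -> beta_basic A q -> beta_basic B q ->
  exists C, [/\ [set: set nat] C, beta_basic C q
    & beta_basic C `<=` beta_basic A `&` beta_basic B].
Proof.
move=> _ _ qA qB; exists (A `&` B); split=> //.
- by case: q qA qB => q uq; exact: filterI.
- move=> r rAB; case: r rAB => r ur rAB.
  by split; apply: filterS rAB => k [].
Qed.

HB.instance Definition _ :=
  isBaseTopological.Build beta_omega beta_basic_cover beta_basic_join.

Definition is_p_limit (Y : topologicalType) (p : set_system nat) (A : set nat)
    (y : nat -> Y) (x : Y) : Prop :=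
  forall U : set Y, nbhs x U -> p [set m | A m /\ U (y m)].

                                                                                
                                                                                
Fixpoint cascade_p_limit (Y : topologicalType) (p : set_system nat) (n : nat)
    (M : set nat) (f : {fset nat} -> Y) (x : Y) : Prop :=
  match n with
  | 0 => f fset0 = x
  | k.+1 =>
    exists (A : set nat) (y : nat -> Y),
      [/\ p A, A `<=` M,
          forall m, A m ->
            cascade_p_limit p k (M `\` `I_m.+1)
              (fun s => f (m |` s)%fset) (y m)
        & is_p_limit p A y x]
  end.

Definition cascade_countably_compact (n : nat) (Y : topologicalType) : Prop :=
  forall f : {fset nat} -> Y,
    exists2 p : set_system nat, free_ultrafilter p &
      exists x : Y, cascade_p_limit p n setT f x.

(* Main.v *)
Require Import Defs.
From mathcomp Require Import all_boot finmap.
From mathcomp Require Import boolp classical_sets functions cardinality filter.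
From mathcomp Require Import topology.

Local Open Scope classical_set_scope.

(** The proof finds an infinite M such that, for free ultrafilters p on M, each
    iterated p-limit of f over M either is a value of f or determines p.  The values of f
    are never in X, and the other limits are avoided by counting: there are 2^c
    ultrafilters p, while countably many iterated limits, each determining p, have
    to stay out of a set with fewer than 2^c points.

    To find M, only countably many values of f matter, and countably many subsets
    of omega separate them; so f may be replaced by a function on [omega]^n with
    values in the Cantor space.  There convergent sequences are available, whose
    limits do not change under thinning, and [canonical_form] holds: on some
    [M]^n the function depends only on the first d elements of its argument, and the
    finite sets of values obtained by fixing the d-th element form a strongly
    discrete family.  Consequently every D has a set W that belongs to f(t)
    exactly when the d-th element of t is in D ([separating_sets]).  If a sequence s
    of fewer than d elements is fixed and the other variables are sent to their
    limits along p, then the resulting limit contains W exactly when p contains D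
    ([ilim_separating]); so p can be recovered from the limit.  Once d elements are
    fixed, the limits are values of f ([ilim_constant]).

    The counting is done in [diagonal_choice], the 2^c free ultrafilters on M being
    indexed by sequences of families of sets ([free_ultrafilters]).  That the
    iterated limits along a good p witness the cascade recursion is
    [cascade_ilim]. *)

(** * Increasing sequences in unbounded sets of naturals *)

(** Infinitude of a set of naturals in the form in which it is used: elements
    are picked above a prescribed bound. *)
Definition unbounded (M : set nat) : Prop := forall N, exists2 m, M m & N <= m.

(** The set [M]^n, an n-element set being listed increasingly, so that a
    recursion can add a new largest element by [rcons]. *)
Definition increasing (M : set nat) n : set (seq nat) :=
  [set l | [/\ size l = n, pairwise ltn l & {in l, forall x, M x}]].

Lemma increasingS {M M' : set nat} {n l} :
  M `<=` M' -> increasing M n l -> increasing M' n l.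
Proof. by move=> sMM' [sl pl Ml]; split=> // x xl; exact/sMM'/Ml. Qed.

Lemma increasing_rcons {M n s m} :
  increasing M n.+1 (rcons s m) <->
  [/\ increasing M n s, M m & all (gtn m) s].
Proof.
rewrite /increasing /= size_rcons pairwise_rcons; split.
- move=> [[ss] /andP[sm ps] Ms]; split=> //.
  + by split=> // x xs; apply: Ms; rewrite mem_rcons inE xs orbT.
  + by apply: Ms; rewrite mem_rcons inE eqxx.
- move=> [[-> -> Ms] Mm sm]; split=> //; first by rewrite andbT.
  by move=> x; rewrite mem_rcons inE => /predU1P[->//|]; exact: Ms.
Qed.

Lemma increasing_take {M n d l} :
  d <= n -> increasing M n l -> increasing M d (take d l).
Proof.
move=> dn [sl pl Ml]; split; first by rewrite size_takel ?sl.
- by rewrite -(cat_take_drop d l) pairwise_cat in pl; case/and3P: pl.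
- by move=> x /mem_take; exact: Ml.
Qed.

Lemma take_rcons {T : Type} d (s : seq T) m :
  d <= size s -> take d (rcons s m) = take d s.
Proof. by move=> ds; rewrite -cats1 takel_cat. Qed.

Lemma leq_last s x : pairwise ltn s -> x \in s -> x <= last 0 s.
Proof.
elim/last_ind: s => [//|s y _]; rewrite pairwise_rcons last_rcons mem_rcons inE.
by move=> /andP[/allP sy _] /predU1P[->//|/sy /ltnW].
Qed.

Definition running_max (r : nat -> nat) b := \max_(i < b) r i.

Lemma leq_running_max r i b : i < b -> r i <= running_max r b.
Proof. by move=> ib; exact: (leq_bigmax (Ordinal ib)). Qed.

Lemma running_max_mono r : {homo running_max r : b c / b <= c}.
Proof.
move=> b c bc; apply/bigmax_leqP => i _.
by apply: leq_running_max; exact: leq_trans bc.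
Qed.

(** Only finitely many increasing sequences lie below a bound, hence the maximum
    exists; this is what turns countably many requirements into finitely many at
    each stage of a diagonal construction. *)
Lemma finite_bound (N : seq nat -> nat) b :
  exists K, forall s, pairwise ltn s -> all (gtn b) s -> N s <= K.
Proof.
elim: b N => [|b IH] N.
  by exists (N [::]); case.
have [K1 hK1] := IH N; have [K2 hK2] := IH (fun s => N (rcons s b)).
exists (maxn K1 K2) => s; case/lastP: s => [|s y].
  by move=> _ _; rewrite leq_max hK1.
rewrite pairwise_rcons all_rcons => /andP[sy ps] /andP[/= yb sb].
rewrite leq_max; move: yb; rewrite ltnS leq_eqVlt => /predU1P[yb|yb].
  by rewrite -yb in hK2 *; rewrite hK2 ?orbT.
rewrite hK1 // ?pairwise_rcons ?sy // all_rcons /= yb.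
by apply: sub_all sy => x /= /ltn_trans; exact.
Qed.

(** Diagonal argument: choose one decreasing chain of unbounded sets that decides
    the sets [S e] one at a time, and pick the k-th point in the k-th set. *)
Lemma cohesive (L : countType) (S : L -> set nat) M : unbounded M ->
  exists M', [/\ M' `<=` M, unbounded M' & forall e, exists c : bool, exists N,
    forall m, M' m -> N <= m -> (S e m <-> c)].
Proof.
move=> uM.
pose next e (T : set nat) := if `[< unbounded (T `&` S e) >] then T `&` S e
  else T `\` S e.
have unext e T : unbounded T -> unbounded (next e T).
  rewrite /next => uT; case: asboolP => // /existsNP[N0 hN0] N.
  have [m Tm Nm] := uT (maxn N0 N); rewrite geq_max in Nm.
  case/andP: Nm => N0m Nm; exists m => //; split=> // Sm.
  by apply: hN0; exists m.
pose enext k T := if (choice.unpickle k : option L) is Some e then next e T else T.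
pose T := fix T k := if k is k'.+1 then enext k' (T k') else M.
have uT k : unbounded (T k).
  elim: k => //= k IH; rewrite /enext; case: (choice.unpickle k) => // e.
  exact: unext.
have sT k j : k <= j -> T j `<=` T k.
  elim: j => [|j IH]; first by rewrite leqn0 => /eqP ->.
  rewrite leq_eqVlt => /predU1P[->//|/IH kj]; apply: subset_trans kj => /=.
  rewrite /enext /next; case: (choice.unpickle j) => // e; case: asboolP => _ x [] //.
have /choice[a ha] : forall k, exists m, T k m /\ k <= m.
  by move=> k; have [m] := uT k k; exists m.
exists (range a); split.
- by move=> _ [k _ <-]; exact: (sT 0 k _ _ (ha k).1).
- by move=> N; exists (a N); [exists N | exact: (ha N).2].
- move=> e; pose i := choice.pickle e.
  exists `[< unbounded (T i `&` S e) >], (running_max a i.+1).+1 => m [k _ <-] am.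
  have ik : i < k.
    by rewrite ltnNge; apply/negP => ki; move: am; rewrite ltnNge leq_running_max.
  have := sT _ _ ik _ (ha k).1; rewrite /= /enext /i choice.pickleK /next -/i.
  by case: asboolP => _ [].
Qed.

(** * Thinning and Ramsey's theorem *)

(** The increment is prescribed by the previous point: each new point is at least
    the value of [R] at the successor of the preceding one, [R 0] serving for the
    first. *)
Lemma sparse_enumeration (R : nat -> nat) M : unbounded M ->
  exists a : nat -> nat, [/\ forall k, M (a k), {mono a : i j / i <= j},
    R 0 <= a 0 & forall k, R (a k).+1 <= a k.+1].
Proof.
move=> uM.
have /choice[nx hnx] : forall N0, exists m, M m /\ N0 <= m.
  by move=> N0; have [m] := uM N0; exists m.
pose a := fix a k := if k is k'.+1
  then nx (maxn (R (a k').+1) (a k').+1) else nx (R 0).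
have aS k : R (a k).+1 <= a k.+1 /\ a k < a k.+1.
  by have [_] := hnx (maxn (R (a k).+1) (a k).+1); rewrite geq_max => /andP.
exists a; split=> [k||| k].
- by case: k => [|k]; exact: (hnx _).1.
- by apply: leq_mono; apply: homo_ltn => [|k]; [exact: ltn_trans|exact: (aS k).2].
- exact: (hnx _).2.
- exact: (aS k).1.
Qed.

Lemma geq_id_mono (a : nat -> nat) : {mono a : i j / i <= j} -> forall k, k <= a k.
Proof.
by move=> am; elim=> // k IH; apply: leq_ltn_trans IH _; rewrite (leqW_mono am).
Qed.

(** The successors make the bound strict and give the empty sequence the bound 0. *)
Definition upper (s : seq nat) := \max_(x <- s) x.+1.

Lemma upperP s : all (gtn (upper s)) s.
Proof.
by apply/allP => x xs; rewrite /= /upper; exact: (leq_bigmax_seq (F := S)).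
Qed.

Lemma sub_upper s t : {subset t <= s} -> all (gtn (upper s)) t.
Proof. by move=> ts; apply/allP => x /ts xs; exact: (allP (upperP s)). Qed.

(** Fusion. If each pair (b, s) makes [P b s m] hold for all large m in [M], then
    an unbounded subset of [M] is so sparse that [P] holds at every one of its
    points m, for all sequences s below the part of the subset chosen before m.
    The sequence t names that part: its elements need not belong to s, which
    lets requirements on s depend on further chosen points below m. *)
Lemma thinning (P : nat -> seq nat -> nat -> Prop) M : unbounded M ->
  (forall b s, exists N, forall m, M m -> N <= m -> P b s m) ->
  exists M', [/\ M' `<=` M, unbounded M' &
    forall m t s, M' m -> {in t, forall x, M' x} -> all (gtn m) t ->
      pairwise ltn s -> all (gtn (upper t)) s -> P (upper t) s m].
Proof.
move=> uM hP.
have /choice[N hN] : forall bs : nat * seq nat, exists N, forall m, M m ->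
    N <= m -> P bs.1 bs.2 m by case=> b s; exact: hP.
have /choice[K hK] := fun b => finite_bound (fun s => N (b, s)) b.
pose R b := running_max K b.+1.
have hR b s m : pairwise ltn s -> all (gtn b) s -> M m -> R b <= m -> P b s m.
  move=> ps sb Mm Rm; apply: (hN (b, s)) => //.
  by apply: leq_trans (hK b s ps sb) (leq_trans _ Rm); exact: leq_running_max.
have Rmono b c : b <= c -> R b <= R c by move=> bc; exact: running_max_mono.
have [a [Ma ale a0 aS]] := sparse_enumeration R M uM.
exists (range a); split.
- by move=> _ [k _ <-].
- by move=> N0; exists (a N0); [exists N0 | exact: geq_id_mono].
- move=> _ t s [k _ <-] ta tm ps sb; apply: hR => //.
  case: k tm => [|k] tm.
    case: t ta tm sb => [_ _ _|x t ta /andP[/= x0 _]]; last first.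
      have [j _ jx] := ta x (mem_head _ _).
      by move: x0; rewrite -jx /= (leqW_mono ale j 0).
    by rewrite /upper big_nil.
  apply: leq_trans (aS k); apply: Rmono; apply/bigmax_leqP_seq => x xt _.
  have [j _ jx] := ta x xt; have := allP tm _ xt.
  by rewrite /= -jx (leqW_mono ale j k.+1) !ltnS (ale j k).
Qed.

(** Ramsey's theorem, by induction on n: on a cohesive set the colour of
    [rcons s m] stabilizes as m grows, so it becomes a colouring of n-sequences,
    and a thinning makes the limit colour the actual one. *)
Lemma ramsey n (c : seq nat -> Prop) M : unbounded M ->
  exists M', [/\ M' `<=` M, unbounded M' &
    (forall l, increasing M' n l -> c l) \/
    (forall l, increasing M' n l -> ~ c l)].
Proof.
elim: n c M => [|n IH] c M uM.
  exists M; split=> //; have [c0|c0] := pselect (c [::]); [left|right];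
  by move=> l [/size0nil ->].
have [M1 [sM1 uM1 hM1]] := cohesive _ (fun s => [set m | c (rcons s m)]) M uM.
have /choice[c' hc'] : forall s, exists b : bool, exists N, forall m, M1 m ->
    N <= m -> (c (rcons s m) <-> b) := hM1.
have [M2 [sM2 uM2 hom]] := IH (fun s => c' s) M1 uM1.
have [M3 [sM3 uM3 hM3]] := thinning
  (fun _ s m => c (rcons s m) <-> c' s) M2 uM2 (fun _ s =>
     let: ex_intro N hN := hc' s in
     ex_intro _ N (fun m Mm Nm => hN m (sM2 m Mm) Nm)).
have {}hM3 s m : increasing M3 n.+1 (rcons s m) -> c (rcons s m) <-> c' s.
  move=> /increasing_rcons[[_ ps Ms] Mm sm].
  by apply: (hM3 m s s Mm) => //; exact: sub_upper.
exists M3; split=> //; first by move=> x /sM3/sM2/sM1.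
case: hom => hom; [left|right] => l; case/lastP: l => [[]//|s m] lM;
rewrite hM3 //; apply: hom;
by have [+ _ _] := increasing_rcons.1 lM; exact: increasingS.
Qed.

(** * A canonical form for functions into the Cantor space *)

(** Closeness in the Cantor space: the relations [agree k] are the basic
    entourages of its uniformity. *)
Definition agree k (x y : nat -> bool) := forall i, i < k -> x i = y i.

Lemma agree_sym {k x y} : agree k x y -> agree k y x.
Proof. by move=> xy i /xy. Qed.

Lemma agree_trans {k} y {x z} : agree k x y -> agree k y z -> agree k x z.
Proof. by move=> xy yz i ik; rewrite xy ?yz. Qed.

Lemma agree_mono {k k' x y} : k <= k' -> agree k' x y -> agree k x y.
Proof. by move=> kk' xy i ik; apply: xy; exact: leq_trans kk'. Qed.

Lemma neq_agree x y : x <> y -> exists k, ~ agree k x y.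
Proof.
move=> xy; apply: contrapT => /forallNP h; apply: xy; apply: funext => i.
by have /contrapT := h i.+1; exact.
Qed.

Lemma last_mem {M d u} : increasing M d u -> 0 < d -> last 0 u \in u.
Proof. by case: u => [[<-]//|x u] _ _; exact: mem_last. Qed.

(** The finite sets of values taken on sequences with a given maximum form a
    strongly discrete family: around the values with maximum m, the
    neighbourhoods of radius [r m] miss all values with larger maximum.  For d = 0
    the condition is void, every last element being the default 0. *)
Definition separated (M : set nat) d (g : seq nat -> nat -> bool) :=
  exists r : nat -> nat, forall u v, increasing M d u -> increasing M d v ->
    last 0 u < last 0 v -> ~ agree (r (last 0 u)) (g u) (g v).

Lemma separatedS {M M' d g} : M' `<=` M -> separated M d g -> separated M' d g.
Proof.
move=> sM [r hr]; exists r => u v uM vM; apply: hr; exact: increasingS sM _.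
Qed.

(** Sequential compactness of the Cantor space, for countably many sequences at
    once: a cohesive set for the coordinate functions makes all of them converge. *)
Lemma convergent_thinning (f : seq nat -> nat -> bool) M : unbounded M ->
  exists M' F, [/\ M' `<=` M, unbounded M' & forall s k, exists N,
    forall m, M' m -> N <= m -> agree k (f (rcons s m)) (F s)].
Proof.
move=> uM.
have [M1 [sM1 uM1]] := cohesive _ (fun si => [set m | f (rcons si.1 m) si.2]) M uM.
move=> /choice[F hF].
exists M1, (fun s i => F (s, i)); split=> // s k.
have /choice[N hN] : forall i, exists N, forall m, M1 m -> N <= m ->
    f (rcons s m) i = F (s, i).
  move=> i; have [N hN] := hF (s, i); exists N => m Mm Nm.
  by apply/idP/idP => /(hN m Mm Nm).
exists (running_max N k) => m Mm Nm i ik; apply: hN => //.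
by apply: leq_trans Nm; exact: leq_running_max.
Qed.

Section off_limits.
Variables (n d : nat) (M : set nat) (f F g : seq nat -> nat -> bool).
Hypotheses (dn : d <= n) (uM : unbounded M)
  (cvgF : forall s k, exists N,
    forall m, M m -> N <= m -> agree k (f (rcons s m)) (F s))
  (Fg : forall s, increasing M n s -> F s = g (take d s))
  (sepg : separated M d g)
  (fF : forall s m, increasing M n.+1 (rcons s m) -> f (rcons s m) <> F s).

(** The values of f avoid a whole neighbourhood of the set of limits F s'.  On a
    sparse set f (rcons s m) is very close to F s, and F s' is separated from F s
    whenever the last relevant coordinate of s' exceeds that of s.  What remains
    is finitely many values F s', those whose relevant coordinates lie below m;
    none of them is f (rcons s m): a value other than F s is avoided for m large
    by convergence, and F s itself by hypothesis. *)
Lemma off_limits : exists M' t, [/\ M' `<=` M, unbounded M' &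
  forall s m s', increasing M' n.+1 (rcons s m) -> increasing M' n s' ->
    ~ agree (t m) (f (rcons s m)) (F s')].
Proof.
have [r hr] := sepg.
pose P b s m := agree (running_max r b) (f (rcons s m)) (F s) /\
  (increasing M n.+1 (rcons s m) ->
   forall u, pairwise ltn u -> all (gtn b) u -> f (rcons s m) <> g u).
have hP b s : exists N, forall m, M m -> N <= m -> P b s m.
  have [N0 hN0] := cvgF s (running_max r b).
  have /choice[N hN] : forall u, exists N, forall m, M m -> N <= m ->
      increasing M n.+1 (rcons s m) -> f (rcons s m) <> g u.
    move=> u; have [->|/nesym /neq_agree[k hk]] := pselect (g u = F s).
      by exists 0 => m _ _; exact: fF.
    have [N hN] := cvgF s k; exists N => m Mm Nm _ fg; apply: hk.
    by rewrite -fg; apply: agree_sym; exact: hN.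
  have [K hK] := finite_bound N b.
  exists (maxn N0 K) => m Mm; rewrite geq_max => /andP[N0m Km].
  split; first exact: hN0.
  move=> smM u pu ub; apply: hN => //; exact: leq_trans (hK u pu ub) Km.
have [M' [sM' uM' hM']] := thinning P M uM hP.
have /choice[t0 ht0] : forall m, exists K, forall s u,
    increasing M' n.+1 (rcons s m) -> increasing M' d u -> all (gtn m) u ->
    ~ agree K (f (rcons s m)) (g u).
  move=> m.
  have /choice[K hK] : forall su : seq nat * seq nat, exists K,
      increasing M' n.+1 (rcons su.1 m) -> increasing M' d su.2 ->
      all (gtn m) su.2 -> ~ agree K (f (rcons su.1 m)) (g su.2).
    case=> s u /=.
    have [[smM uMM um]|no] := pselect [/\ increasing M' n.+1 (rcons s m),
      increasing M' d u & all (gtn m) u]; last first.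
      by exists 0 => smM uMM um; case: no.
    have [[_ ps Ms] Mm sm] := increasing_rcons.1 smM; have [_ pu Mu] := uMM.
    have [_] : P (upper (s ++ u)) s m.
      apply: hM' => //.
      - by move=> x; rewrite mem_cat => /orP[/Ms|/Mu].
      - by rewrite all_cat sm.
      - by apply: sub_upper => x xs; rewrite mem_cat xs.
    move=> /(_ (increasingS sM' smM) u pu) fg.
    have /neq_agree[k hk] : f (rcons s m) <> g u.
      by apply: fg; apply: sub_upper => x xu; rewrite mem_cat xu orbT.
    by exists k.
  have /choice[K1 hK1] := fun s => finite_bound (fun u => K (s, u)) m.
  have [K2 hK2] := finite_bound K1 m.
  exists K2 => s u smM uMM um.
  have [[_ ps _] _ sm] := increasing_rcons.1 smM; have [_ pu _] := uMM.
  move=> fg; apply: (hK (s, u)) => //; apply: agree_mono fg.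
  by apply: leq_trans (hK1 s u pu um) (hK2 s ps sm).
exists M', (fun m => maxn (t0 m) (running_max r m)); split=> // s m s' smM s'M fF'.
have [sM Mm sm] := increasing_rcons.1 smM; have [ss ps Ms] := sM.
have [close _] : P (upper s) s m by apply: hM' => //; exact: upperP.
have s'M' := increasingS sM' s'M.
have uM1 := increasing_take dn (increasingS sM' sM).
have uM2 := increasing_take dn s'M'.
rewrite (Fg _ s'M') in fF'; rewrite (Fg _ (increasingS sM' sM)) in close.
(* The case where the values of F that matter are finitely many. *)
have low : all (gtn m) (take d s') -> False.
  move=> s'm; apply: (ht0 m s (take d s')) => //; first exact: (increasing_take dn s'M).
  by apply: agree_mono (leq_maxl _ _) fF'.
have [d0|d0] := posnP d; first by apply: low; rewrite d0 take0.
have es := mem_take (last_mem uM1 d0).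
have eb : last 0 (take d s) < upper s by exact: (allP (upperP s) _ es).
have em : last 0 (take d s) < m by exact: (allP sm _ es).
have [le|lt] := leqP (last 0 (take d s')) (last 0 (take d s)).
  apply: low; apply/allP => x xs'; have [_ ps' _] := uM2.
  exact: leq_ltn_trans (leq_trans (leq_last _ _ ps' xs') le) em.
apply: (hr _ _ uM1 uM2 lt); apply: (agree_trans (f (rcons s m))).
- exact: agree_sym (agree_mono (leq_running_max _ _ _ eb) close).
- by apply: agree_mono fF'; rewrite leq_max (leq_running_max _ _ _ em) orbT.
Qed.
End off_limits.

(** Induction on n, through the limit function F of f in its last variable, to
    which the canonical form in one variable less applies.  By Ramsey's theorem,
    either f always equals its limit, and then it inherits the canonical form of
    F; or it never does, and then f itself is separated.  In the latter case let
    m < m' be the last elements of two sequences: f at the second one is as close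
    as desired to a value of F, whatever the other elements are, while f at the
    first one stays away from all values of F by a distance depending on m only. *)
Lemma canonical_form n (f : seq nat -> nat -> bool) M : unbounded M ->
  exists M' d g, [/\ M' `<=` M, unbounded M', d <= n,
    forall l, increasing M' n l -> f l = g (take d l) & separated M' d g].
Proof.
elim: n f M => [|n IH] f M uM.
  exists M, 0, f; split=> //; first by move=> l [/size0nil ->].
  by exists id => u v [/size0nil -> _ _] [/size0nil ->].
have [M1 [F [sM1 uM1 cvgF]]] := convergent_thinning f M uM.
have [M2 [d [g [sM2 uM2 dn Fg sepg]]]] := IH F M1 uM1.
have [M3 [sM3 uM3 hom]] := ramsey n.+1 (fun l => f l = F (take n l)) M2 uM2.
have takeE s m : increasing M3 n.+1 (rcons s m) -> take n (rcons s m) = s.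
  move=> /increasing_rcons[[ss _ _] _ _].
  by rewrite take_rcons ?ss // take_oversize ?ss.
case: hom => hom.
  exists M3, d, g; split=> //.
  - by move=> x /sM3/sM2/sM1.
  - exact: leqW.
  - move=> l; case/lastP: l => [[]//|s m] lM.
    rewrite hom // takeE //; have [sM _ _] := increasing_rcons.1 lM.
    by rewrite (Fg _ (increasingS sM3 sM)) take_rcons //; case: sM => ->.
  - exact: separatedS sepg.
have [M4 [t [sM4 uM4 far]]] : exists M' t, [/\ M' `<=` M3, unbounded M' &
  forall s m s', increasing M' n.+1 (rcons s m) -> increasing M' n s' ->
    ~ agree (t m) (f (rcons s m)) (F s')].
  apply: (off_limits n d M3 f F g dn uM3).
  - move=> s k; have [N hN] := cvgF s k; exists N => m Mm; apply: hN.
    exact/sM2/sM3.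
  - by move=> s sM; apply: Fg; exact: increasingS sM.
  - exact: separatedS sepg.
  - by move=> s m smM; have := hom _ smM; rewrite takeE.
(* The bound b will exceed both the first n elements of the second sequence and
   the last element m of the first one, so the closeness is at least t m. *)
have [|M5 [sM5 uM5 close]] :=
    thinning (fun b s m => agree (running_max t b) (f (rcons s m)) (F s)) M4 uM4.
  move=> b s; have [N hN] := cvgF s (running_max t b); exists N => m Mm; apply: hN.
  exact/sM2/sM3/sM4.
exists M5, n.+1, f; split=> //.
- by move=> x /sM5/sM4/sM3/sM2/sM1.
- by move=> l [sl _ _]; rewrite take_oversize // sl.
exists t => l l'; case/lastP: l => [[]//|s m]; case/lastP: l' => [_ []//|s' m'].
move=> lM lM'; rewrite !last_rcons => mm' ff'.
have [_ Mm _] := increasing_rcons.1 lM.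
have [[s's ps' Ms'] Mm' sm'] := increasing_rcons.1 lM'.
have cl : agree (running_max t (upper (m :: s'))) (f (rcons s' m')) (F s').
  apply: close => //=.
  - by move=> x; rewrite inE => /predU1P[->|/Ms'].
  - by rewrite mm'.
  - by apply: sub_upper => x xs'; rewrite inE xs' orbT.
apply: (far s m s'); [exact: increasingS lM | exact: (increasingS sM5) |].
apply: agree_trans ff' (agree_mono _ cl); apply: leq_running_max.
by apply: (allP (upperP (m :: s'))); exact: mem_head.
Qed.

(** * Many free ultrafilters *)

Lemma ultra_intro {T : Type} (F : set_system T) :
  ProperFilter F -> (forall A, F A \/ F (~` A)) -> UltraFilter F.
Proof.
move=> PF FC; split=> // G PG FG; apply/seteqP; split=> // A GA.
have [//|/FG GCA] := FC A; case: (@filter_not_empty _ G _).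
by rewrite -(setICr A); exact: filterI.
Qed.

Lemma filter_congr {T : Type} (p : set_system T) (D A B : set T) : ProperFilter p ->
  p D -> (forall m, D m -> A m <-> B m) -> p A <-> p B.
Proof.
move=> pp pD AB; split=> [pA|pB].
  by apply: filterS (filterI pD pA) => m [Dm]; exact: (AB m Dm).1.
by apply: filterS (filterI pD pB) => m [Dm]; exact: (AB m Dm).2.
Qed.

Lemma filter_const {T : Type} (p : set_system T) (Q : Prop) : ProperFilter p ->
  p [set _ | Q] <-> Q.
Proof.
move=> pp; split=> [pQ|q]; last by apply: filterS filterT.
by have [] := filter_ex pQ.
Qed.

Lemma ultraC {T : Type} (p : set_system T) (A : set T) : UltraFilter p ->
  p (~` A) <-> ~ p A.
Proof.
move=> up; split=> [pC pA|nA]; last by case: (in_ultra_setVsetC A up).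
case: (@filter_not_empty _ p _); rewrite -(setICr A); exact: filterI.
Qed.

(** The standard independent family: the subset of nat * seq (nat * seq bool)
    attached to a consists of the pairs (k, L) such that L contains [code k a],
    the first component of a together with the first k bits of the second. *)
Definition code k (a : nat * set nat) := (a.1, mkseq (fun j => `[< a.2 j >]) k).

Lemma code_separates a b : a <> b ->
  exists N, forall k, N <= k -> code k a <> code k b.
Proof.
case: a b => [i A] [j B] ab.
have [ij|ij] := pselect (i = j); last by exists 0 => k _ [].
apply: contrapT => /forallNP no; apply: ab; rewrite -ij; congr (_, _).
apply/seteqP; split=> x xAB; apply: contrapT => nx.
  apply: (no x.+1) => k xk; rewrite /code /= => -[_].
  move=> /(congr1 (fun l => nth false l x)); rewrite !nth_mkseq //.
  by rewrite (asboolT xAB) (asboolF nx).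
apply: (no x.+1) => k xk; rewrite /code /= => -[_].
move=> /(congr1 (fun l => nth false l x)); rewrite !nth_mkseq //.
by rewrite (asboolT xAB) (asboolF nx).
Qed.

Lemma code_inj_on (l : seq (nat * set nat)) :
  exists N, forall k, N <= k -> {in l &, injective (code k)}.
Proof.
have /choice[N hN] : forall ab : (nat * set nat) * (nat * set nat), exists N,
    forall k, N <= k -> code k ab.1 = code k ab.2 -> ab.1 = ab.2.
  case=> a b /=; have [->|/code_separates[N hN]] := pselect (a = b); first by exists 0.
  by exists N => k /hN.
exists (\max_(a <- l) \max_(b <- l) N (a, b)) => k Nk a b al bl.
apply: (hN (a, b)); apply: leq_trans Nk.
apply: leq_trans (leq_bigmax_seq (F := fun a => \max_(b <- l) N (a, b)) _ al _) => //.
exact: (leq_bigmax_seq (F := fun b => N (a, b))).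
Qed.

(** Pospisil's theorem, with the 2^c ultrafilters on [M] indexed by
    sequences of families of sets.  An independent family is transported
    into [M]; the ultrafilter with index c contains the member attached to (i, B)
    exactly when B is in c i.  Independence holds even above every level k, which
    provides the cofinite sets. *)
Lemma free_ultrafilters M : unbounded M ->
  exists P : (nat -> set (set nat)) -> set_system nat,
    (forall c, [/\ UltraFilter (P c), P c M & forall N, P c [set m | N <= m]]) /\
    injective P.
Proof.
move=> uM.
have [e [Me emono _ _]] := sparse_enumeration (fun _ => 0) M uM.
pose Q := (nat * seq (nat * seq bool))%type.
pose h (q : Q) := e (choice.pickle q).
have hinj : injective h.
  by move=> q q' /(incn_inj emono) /(pcan_inj choice.pickleK).
pose fits (c : nat -> set (set nat)) (l : seq (nat * set nat)) (q : Q) :=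
  forall a, a \in l -> (code q.1 a \in q.2) <-> c a.1 a.2.
pose F c : set_system nat := [set A | exists l k0, forall q : Q, k0 <= q.1 ->
  fits c l q -> A (h q)].
have PF c : ProperFilter (F c).
  split.
    move=> [l [k0 hl]]; have [k1 hk] := code_inj_on l.
    (* Level k tells the elements of l apart, so the list of the codes of those
       that c selects realizes exactly the prescribed memberships. *)
    pose k := maxn k0 k1.
    apply: (hl (k, [seq code k a | a <- l & `[< c a.1 a.2 >]])).
      exact: leq_maxl.
    move=> a al; split=> [/mapP[b]|ca].
      rewrite mem_filter => /andP[/asboolP cb bl] eab.
      by rewrite (hk _ (leq_maxr k0 k1) a b).
    by apply: map_f; rewrite mem_filter al andbT; apply/asboolP.
  split.
  - by exists [::], 0.
  - move=> A B [l [k hA]] [l' [k' hB]]; exists (l ++ l'), (maxn k k') => q.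
    rewrite geq_max => /andP[kq k'q] fit; split.
      by apply: hA => // a al; apply: fit; rewrite mem_cat al.
    by apply: hB => // a al; apply: fit; rewrite mem_cat al orbT.
  - by move=> A B AB [l [k hA]]; exists l, k => q kq /hA/AB; exact.
have /choice[P hP] : forall c, exists G, UltraFilter G /\ F c `<=` G.
  by move=> c; exact: ultraFilterLemma.
exists P; split=> [c|c c' PP].
  have [uP sP] := hP c; split=> //.
    by apply: sP; exists [::], 0 => q _ _; exact: Me.
  move=> N; apply: sP.
  have /choice[K hK] : forall j, exists K, forall q, h q = j -> q.1 < K.
    move=> j; have [[q hq]|no] := pselect (exists q, h q = j).
      by exists q.1.+1 => q' hq'; rewrite (hinj q' q) // hq.
    by exists 0 => q hq; case: no; exists q.
  exists [::], (running_max K N) => q Kq _ /=; rewrite leqNgt; apply/negP => hN.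
  have := hK _ q erefl; rewrite ltnNge (leq_trans _ Kq) //.
  exact: (leq_running_max K).
pose T a := [set m | exists2 q, h q = m & code q.1 a \in q.2].
have PT d a : P d (T a) <-> d a.1 a.2.
  have [uP sP] := hP d; split=> [PTa|da]; last first.
    apply: sP; exists [:: a], 0 => q _ fit; exists q => //.
    by apply/(fit a); rewrite ?mem_head.
  apply: contrapT => nda; apply: (iffLR (ultraC _ (T a) uP)) => //.
  apply: sP; exists [:: a], 0 => q _ fit [q' /hinj -> qa]; apply: nda.
  by apply/(fit a); rewrite ?mem_head.
apply: funext => i; apply/seteqP; split=> B.
  by move/(PT c (i, B)).2; rewrite PP => /(PT c' (i, B)).1.
by move/(PT c' (i, B)).2; rewrite -PP => /(PT c (i, B)).1.
Qed.

(** * Iterated limits along an ultrafilter *)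

(** The limit of [e] on the extensions of s by k further elements, each taken
    along p.  A point of the compactification is encoded by its ultrafilter, and
    the p-limit of ultrafilters u m is the set of those A that are in p-almost
    every u m. *)
Fixpoint ilim (p : set_system nat) (e : seq nat -> set_system nat) k s :
    set_system nat :=
  if k is k'.+1 then [set A | p [set m | ilim p e k' (rcons s m) A]] else e s.

Lemma ilim_ultra p e k s : UltraFilter p -> (forall l, UltraFilter (e l)) ->
  UltraFilter (ilim p e k s).
Proof.
move=> up ue; elim: k s => [|k IH] s //=.
apply: ultra_intro.
  split=> [/= p0|].
    have [m m0] := filter_ex p0; have um := IH (rcons s m).
    by case: (@filter_not_empty _ _ (@ultra_proper _ _ um)).
  split=> /=.
  - apply: filterS filterT => m _; have := IH (rcons s m) => ?; exact: filterT.
  - move=> A B pA pB; apply: (@filterS _ p _ _ _ _ (@filterI _ p _ _ _ pA pB)).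
    move=> m [/= ? ?].
    have := IH (rcons s m) => ?; exact: filterI.
  - move=> A B AB; apply: filterS => m /=; have := IH (rcons s m) => ?.
    exact: filterS.
move=> A; have [|] := in_ultra_setVsetC [set m | ilim p e k (rcons s m) A] up.
  by left.
move=> pC; right; apply: filterS pC => m /=; have um := IH (rcons s m).
by move/(ultraC _ A um).
Qed.

Section limits.
Variables (n d : nat) (M : set nat) (e : seq nat -> set_system nat).
Hypotheses (dn : d <= n).

Definition tail s := [set m | M m /\ all (gtn m) s].

Lemma filter_tail {p} s : ProperFilter p -> p M ->
  (forall N, p [set m | N <= m]) -> p (tail s).
Proof.
move=> pp pM pN; apply: filterS (filterI pM (pN (upper s))) => m [Mm sm].
split=> //; apply: sub_all (upperP s) => x xs; exact: leq_trans xs sm.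
Qed.

Lemma increasing_tail j s m :
  increasing M j s -> tail s m -> increasing M j.+1 (rcons s m).
Proof. by move=> sM [Mm sm]; apply/increasing_rcons. Qed.

Variable (p : set_system nat).
Hypotheses (up : UltraFilter p) (pM : p M) (pN : forall N, p [set m | N <= m]).
Let pp : ProperFilter p := @ultra_proper _ _ up.

(** If [W] reads off whether the d-th element of a sequence belongs to [D], then
    the limits that are still to pass through the d-th variable contain [W] exactly
    when [D] is in p.  Hence such a limit determines p. *)
Lemma ilim_separating (D W : set nat) :
  (forall l, increasing M n l -> e l W <-> D (last 0 (take d l))) ->
  forall k j s, j + k = n -> increasing M j s ->
    ilim p e k s W <-> if d <= j then D (last 0 (take d s)) else p D.
Proof.
move=> hW; elim=> [|k IH] j s.
  by rewrite addn0 => -> sM; rewrite dn; exact: hW.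
rewrite addnS -addSn => jk sM /=.
have [ss _ _] := sM.
have pT := filter_tail s pp pM pN.
have stepE : p [set m | ilim p e k (rcons s m) W] <->
    p [set m | if d <= j.+1 then D (last 0 (take d (rcons s m))) else p D].
  by apply: (filter_congr _ _ _ _ pp pT) => m /(increasing_tail _ _ _ sM)/(IH _ _ jk).
apply: (iff_trans stepE).
have [dj|] := leqP d j.
  rewrite leqW //; apply: iff_trans (filter_const p _ pp).
  by under eq_set => m do rewrite take_rcons ?ss //.
rewrite leq_eqVlt => /predU1P[<-|jd].
  by rewrite leqnn; under eq_set => m do
    rewrite take_oversize ?size_rcons ?ss // last_rcons.
by rewrite leqNgt jd /=; exact: filter_const pp.
Qed.

(** The limits taken after the d-th variable are limits of constant sequences, so
    they are themselves values of [e]. *)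
Lemma ilim_constant l : increasing M n l ->
  (forall l', increasing M n l' -> take d l' = take d l -> e l' = e l) ->
  forall k j s, j + k = n -> increasing M j s -> d <= j ->
    take d s = take d l -> ilim p e k s = e l.
Proof.
move=> lM el; elim=> [|k IH] j s.
  by rewrite addn0 => ->; move=> sM _; exact: el.
rewrite addnS -addSn => jk sM dj sl /=; have [ss _ _] := sM.
apply/funext => A; apply/propext.
apply: iff_trans (filter_const p (e l A) pp).
apply: (filter_congr _ _ _ _ pp (filter_tail s pp pM pN)) => m sm /=.
rewrite (IH j.+1) ?leqW //; first exact: increasing_tail.
by rewrite take_rcons ?ss.
Qed.

End limits.

Lemma increasing_extend M k j s : unbounded M -> increasing M j s ->
  exists l, increasing M (j + k) (s ++ l).
Proof.
move=> uM; elim: k j s => [|k IH] j s sM.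
  by exists [::]; rewrite addn0 cats0.
have [m Mm sm] := uM (upper s).
have [|l lM] := IH j.+1 (rcons s m).
  apply/increasing_rcons; split=> //.
  by apply: sub_all (upperP s) => x xs; exact: leq_trans xs sm.
by exists (m :: l); rewrite addnS -addSn -cat_rcons.
Qed.

(** A strongly discrete family can be split along any set [D] of indices by
    disjoint open sets; here these are unions of finite Boolean combinations of
    the sets [B i], which play the role of coordinates. *)
Lemma separating_sets (n d : nat) (M : set nat) (e : seq nat -> set_system nat)
    (B : nat -> set nat) (g : seq nat -> nat -> bool) :
  (forall l, UltraFilter (e l)) -> d <= n -> separated M d g ->
  (forall l, increasing M n l -> forall i, `[< e l (B i) >] = g (take d l) i) ->
  forall D, exists W, forall l, increasing M n l ->
    e l W <-> D (last 0 (take d l)).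
Proof.
move=> ue dn [r hr] eg.
(* Radii that grow with the last element: if x is close to both g u and g v, then
   g u and g v agree up to the smaller of the two radii. *)
pose V D := [set x | exists u, [/\ increasing M d u, D (last 0 u) &
  agree (running_max r (last 0 u).+1) (fun i => `[< B i x >]) (g u)]].
have eV D l : increasing M n l -> D (last 0 (take d l)) -> e l (V D).
  move=> lM Dl; set u := take d l; have uM : increasing M d u.
    exact: increasing_take lM.
  have [k ek] : exists k, k = running_max r (last 0 u).+1 by eexists.
  have : e l [set x | agree k (fun i => `[< B i x >]) (g u)].
    elim: (k) => [|i IH]; first by apply: filterS filterT => x _ i.
    have ei : e l [set x | `[< B i x >] = g u i].
      rewrite -eg //; case: asboolP => [eB|neB].
        by apply: filterS eB => x Bx; rewrite /= asboolT.
      have := (ultraC _ _ (ue l)).2 neB.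
      by apply: filterS => x nBx; rewrite /= asboolF.
    apply: (@filterS _ (e l) _ _ _ _ (@filterI _ (e l) _ _ _ IH ei)).
    move=> x [ha hi] j; rewrite ltnS leq_eqVlt => /predU1P[->//|]; exact: ha.
  by apply: filterS => x ux; exists u; split=> //; rewrite -ek.
have disj D : V D `&` V (~` D) `<=` set0.
  move=> x [[u [uM Du ux]] [v [vM Dv vx]]].
  have [lt|lt|eq] := ltngtP (last 0 u) (last 0 v); last by rewrite -eq in Dv.
    apply: (hr u v uM vM lt); apply: agree_trans (agree_mono _ vx).
      by apply/agree_sym/(agree_mono _ ux)/leq_running_max.
    by apply: leq_running_max; exact: ltnW.
  apply: (hr v u vM uM lt); apply: agree_trans (agree_mono _ ux).
    by apply/agree_sym/(agree_mono _ vx)/leq_running_max.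
  by apply: leq_running_max; exact: ltnW.
move=> D; exists (V D) => l lM; split; last exact: eV.
move=> eVD; apply: contrapT => nD; have eVC := eV (~` D) l lM nD.
by have [x /disj] := filter_ex (@filterI _ (e l) _ _ _ eVD eVC).
Qed.

Lemma beta_omega_eq (x y : beta_omega) : beta_filter x = beta_filter y -> x = y.
Proof.
case: x y => [p up] [q uq] /= pq; rewrite pq in up *.
by congr BetaOmega; exact: Prop_irrelevance.
Qed.

(** A form of Konig's inequality.  For a fixed s, an x in [X] determines
    the index c; so, [X] being too small, the c that are bad for s because of a
    point of [X] cannot have all families as their s-th component.  A c whose
    components are all missed in this way is bad for no s. *)
Lemma diagonal_choice {T : Type} (X : set T) (L : countType)
    (bad : L -> (nat -> set (set nat)) -> T -> Prop) :
  ~ ([set: set (set nat)] #<= X)%card ->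
  (forall s c c' x, bad s c x -> bad s c' x -> c = c') ->
  exists c, forall s x, bad s c x -> ~ X x.
Proof.
move=> cX inj.
have /choice[b hb] : forall i, exists b : set (set nat), forall c s x,
    choice.pickle s = i -> c i = b -> bad s c x -> ~ X x.
  move=> i; apply: contrapT => /forallNP no; apply: cX.
  have /choice[x hx] : forall b : set (set nat), exists x, X x /\
      exists s c, [/\ choice.pickle s = i, c i = b & bad s c x].
    move=> b; apply: contrapT => nx; apply: (no b) => c s x si cb bad_x Xx.
    by apply: nx; exists x; split=> //; exists s, c.
  have xinj : injective x.
    move=> b b' xx; have [_ [s [c [si cb bs]]]] := hx b.
    have [_ [s' [c' [si' cb' bs']]]] := hx b'.
    have ss : s = s' by apply: (pcan_inj choice.pickleK); rewrite si.
    by rewrite -ss -xx in bs'; rewrite -cb -cb' (inj _ _ _ _ bs bs').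
  have /card_eqPle[_ le_range] : (range x #= [set: set (set nat)])%card.
    by apply: inj_card_eq => b b' _ _; exact: xinj.
  apply: (card_le_trans le_range); apply: subset_card_le.
  by move=> _ [b _ <-]; exact: (hx b).1.
exists b => s x; exact: hb.
Qed.

(** * Cascade limits *)

(** The sets in the recursion for cascade limits are built by successive
    insertions of minimal elements, which is exactly the nesting here. *)
Definition along {Y : Type} (f : {fset nat} -> Y) l :=
  f (foldr (fun m s => m |` s)%fset fset0 l).

Section cascade.
Variables (X : set beta_omega) (n : nat) (M : set nat) (p : set_system nat).
Variables (f : {fset nat} -> set_type (~` X)) (y : seq nat -> set_type (~` X)).
Hypotheses (up : UltraFilter p) (pM : p M) (pN : forall N, p [set m | N <= m]).
Let e l := beta_filter (val (along f l)).
Hypothesis (hy : forall k j s, j + k = n -> increasing M j s ->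
  beta_filter (val (y s)) = ilim p e k s).

Lemma ilim_p_limit k j s : j + k.+1 = n -> increasing M j s ->
  is_p_limit p (tail M s) (fun m => y (rcons s m)) (y s).
Proof.
move=> jk sM U; rewrite nbhsE => -[V [oV Vy] VU].
case: oV Vy VU => W [D' _ <-] <- [A D'A ysA] AU.
have pA : p [set m | ilim p e k (rcons s m) A].
  have : beta_filter (val (y s)) A := ysA.
  by rewrite (hy _ _ _ jk sM).
have pT : p (tail M s) by exact: filter_tail.
apply: (@filterS _ p _ _ _ _ (@filterI _ p _ _ _ pT pA)) => m [sm Am].
split=> //; apply: AU; exists A => //.
change (beta_filter (val (y (rcons s m))) A).
by rewrite (hy k j.+1) ?addSnnS //; exact: increasing_tail.
Qed.

(** A choice y of points for the iterated limits is a witness for the recursion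
    that defines cascade limits: at each level all one-element extensions within
    [M] form the required set in p. *)
Lemma cascade_ilim k j s N h : j + k = n -> increasing M j s ->
  tail M s `<=` N -> (forall l, along h l = along f (s ++ l)) ->
  cascade_p_limit p k N h (y s).
Proof.
elim: k j s N h => [|k IH] j s N h jk sM sN hf /=.
  apply: val_inj; apply: beta_omega_eq; rewrite (hy _ _ _ jk sM) /= /e.
  by rewrite -(cats0 s) -hf.
exists (tail M s), (fun m => y (rcons s m)); split=> //.
- exact: filter_tail.
- move=> m sm; apply: (IH j.+1); first by rewrite addSnnS.
  + exact: increasing_tail.
  + move=> x [Mx]; rewrite all_rcons => /andP[/= mx sx]; split; first exact: sN.
    by apply/negP; rewrite -leqNgt.
  + by move=> l; rewrite cat_rcons -hf.
- exact: ilim_p_limit jk sM.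
Qed.
End cascade.

Theorem proposition4p3 (n : nat) (X : set beta_omega)
    (hX : card_lt X [set: set (set nat)]) :
  cascade_countably_compact n (set_type (~` X)).
Proof.
move=> f; pose e l := beta_filter (val (along f l)).
have ue l : UltraFilter (e l) := beta_ultra _.
(* Countably many sets separating the values of f: with these as coordinates,
   f becomes a function into the Cantor space. *)
have /choice[B hB] : forall ll : seq nat * seq nat, exists A,
    e ll.1 <> e ll.2 -> ~ (e ll.1 A <-> e ll.2 A).
  case=> l l' /=; have [ee|ne] := pselect (e l = e l'); first by exists setT.
  apply: contrapT => /forallNP no; apply: ne; apply/funext => A; apply/propext.
  by apply: contrapT => nA; apply: (no A).
pose B' i := if choice.unpickle i is Some ll then B ll else setT.
have [M [d [g [_ uM dn eg sepg]]]] :=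
  canonical_form n (fun l i => `[< e l (B' i) >]) setT
    (fun N => ex_intro2 _ _ N I (leqnn N)).
have e_take l l' : increasing M n l -> increasing M n l' ->
    take d l = take d l' -> e l = e l'.
  move=> lM lM' ll; apply: contrapT => /(hB (l, l')) /=; apply.
  have := congr1 (fun x => x (choice.pickle (l, l'))) (eg l lM).
  rewrite ll -eg // /B' choice.pickleK => eB.
  exact: asbool_eq_equiv eB.
have eW := separating_sets n d M e B' g ue dn sepg
  (fun l lM i => congr1 (fun x => x i) (eg l lM)).
have [P [hP Pinj]] := free_ultrafilters M uM.
(* The iterated limits that do depend on p, and must be kept out of X. *)
pose bad s c x := exists j,
  [/\ j < d, increasing M j s & beta_filter x = ilim (P c) e (n - j) s].
have bad_inj s c c' x : bad s c x -> bad s c' x -> c = c'.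
  move=> [j [jd sM xc]] [j' [_ [sj' _ _] xc']]; apply: Pinj.
  have [sj _ _] := sM; rewrite -sj' sj xc in xc'.
  have jn : j + (n - j) = n by rewrite subnKC // ltnW // (leq_trans jd).
  apply/funext => D; apply/propext; have [W hW] := eW D.
  have lim_eq q : UltraFilter (P q) -> P q M ->
      (forall N, P q [set m | N <= m]) -> ilim (P q) e (n - j) s W <-> P q D.
    move=> uq qM qN.
    have := ilim_separating n d M e dn (P q) uq qM qN D W hW _ _ _ jn sM.
    by rewrite leqNgt jd.
  have [u1 M1 N1] := hP c; have [u2 M2 N2] := hP c'.
  apply: iff_trans (iff_sym (lim_eq c u1 M1 N1)) _; rewrite xc'.
  exact: lim_eq.
have [c hc] := diagonal_choice X (seq nat : countType) bad hX.2 bad_inj.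
have [up pM pN] := hP c.
have point k j s : j + k = n -> increasing M j s ->
    exists z : set_type (~` X), beta_filter (val z) = ilim (P c) e k s.
  move=> jk sM; have [jd|dj] := ltnP j d.
    pose x := BetaOmega (ilim_ultra (P c) e k s up ue).
    have nXx : (~` X) x.
      by apply: (hc s x); exists j; split=> //; rewrite /x /= -jk addKn.
    by exists (SigSub (mem_set nXx)).
  have [l lM] := increasing_extend M k j s uM sM; rewrite jk in lM.
  exists (along f (s ++ l)); have [ss _ _] := sM; symmetry.
  apply: (ilim_constant n d M e (P c) up pM pN _ lM _ _ _ _ jk sM dj).
    by move=> l' lM' ll'; exact: e_take.
  by rewrite takel_cat // ss.
have /choice[y hy] : forall s, exists z : set_type (~` X), forall k j,
    j + k = n -> increasing M j s -> beta_filter (val z) = ilim (P c) e k s.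
  move=> s; have [sM|nsM] := pselect (size s <= n /\ increasing M (size s) s).
    have [z hz] := point (n - size s) (size s) s (subnKC sM.1) sM.2.
    exists z => k j jk [sj _ _]; rewrite hz; congr (ilim _ _ _ s).
    by rewrite -jk sj addKn.
  exists (along f [::]) => k j jk sM; case: nsM; have [sj _ _] := sM.
  by rewrite sj; split=> //; rewrite -jk leq_addr.
exists (P c).
  split=> //; apply/seteqP; split=> // m hm.
  by have := hm _ (pN m.+1); rewrite /= ltnn.
exists (y [::]); apply: (cascade_ilim X n M (P c) f y up pM pN _ n 0) => //.
by move=> k j s; exact: hy.
Qed.
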